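(* Let $n, r$ be positive integers and let $V=\{e_1,\dots,e_n\}$ be the set of standard coordinate vectors of $\mathbb{R}^n$. Then the local $h$-polynomial of the $r$-fold edgewise subdivision $\mathrm{esd}_r(2^V)$ satisfies $$\ell_V(\mathrm{esd}_r(2^V),x) \;=\; \mathrm{E}_r\big((x+x^2+\cdots+x^{r-1})^n\big) \;=\; \sum_{w\in \mathcal{S}(n,r)} x^{\mathrm{asc}(w)}.$$
   Context: For $a=(a_1,\dots,a_n)\in\mathbb{Z}^n$ put $\iota(a)=(a_1,a_1+a_2,\dots,a_1+\cdots+a_n)$. Let $\Omega_r=\{(i_1,\dots,i_n)\in\mathbb{Z}_{\ge 0}^n : i_1+\cdots+i_n=r\}$. The $r$-fold edgewise subdivision $\mathrm{esd}_r(2^V)$ is the abstract simplicial complex on vertex set $\Omega_r$ in which a set $G\subseteq\Omega_r$ is a face iff for all $u,v\in G$, $\iota(u)-\iota(v)\in\{0,1\}^n$ or $\iota(v)-\iota(u)\in\{0,1\}^n$. It is realized as a triangulation of the simplex $\mathrm{conv}(\Omega_r)$ (a dilate of the simplex with vertex set $V$), cut by the hyperplanes $x_i+x_{i+1}+\cdots+x_j=k$ ($i\le j$, $k\in\{0,\dots,r\}$). For $F\subseteq V$, the restriction $\Gamma_F$ of $\Gamma=\mathrm{esd}_r(2^V)$ to $F$ is the subcomplex of faces all of whose vertices $u\in\Omega_r$ satisfy $u_i=0$ whenever $e_i\notin F$. The $h$-polynomial of a $(d-1)$-dimensional simplicial complex $\Delta$ is $h(\Delta,x)=\sum_{i=0}^d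 f_{i-1}(\Delta)x^i(1-x)^{d-i}$, where $f_{i}(\Delta)$ is the number of $i$-dimensional faces ($f_{-1}=1$, counting the empty face); here $\Gamma_F$ is regarded as $(|F|-1)$-dimensional. The local $h$-polynomial of a triangulation $\Gamma$ of the simplex $2^V$ with $|V|=n$ is $\ell_V(\Gamma,x)=\sum_{F\subseteq V}(-1)^{n-|F|}h(\Gamma_F,x)$. $\mathrm{E}_r$ is the linear operator on $\mathbb{R}[x]$ with $\mathrm{E}_r(x^m)=x^{m/r}$ if $r$ divides $m$ and $\mathrm{E}_r(x^m)=0$ otherwise. $\mathcal{S}(n,r)$ is the set of sequences $w=(w_0,w_1,\dots,w_n)\in\{0,1,\dots,r-1\}^{n+1}$ with no two consecutive entries equal and with $w_0=w_n=0$. An ascent of $w$ is an index $i\in\{0,1,\dots,n-1\}$ with $w_i<w_{i+1}$, and $\mathrm{asc}(w)$ is the number of ascents. *)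

(* Defs.v *)
From HB Require Import structures.
From mathcomp Require Import all_boot all_order all_algebra.
From mathcomp Require Import reals.

Set Implicit Arguments.
Unset Strict Implicit.
Unset Printing Implicit Defensive.

Import Order.TTheory GRing.Theory Num.Theory.

Local Open Scope ring_scope.

Definition fface (T : finType) (D : {set {set T}}) (i : nat) : nat :=
  #|[set G in D | #|G| == i]|.

(* [fface D i] counts faces of cardinality [i], i.e. it is $f_{i-1}(D)$; [D] is
   regarded as a complex of dimension [d - 1]. *)
Definition hpoly (R : nzRingType) (T : finType) (d : nat) (D : {set {set T}})
    : {poly R} :=
  \sum_(i < d.+1) (fface D i)%:R * 'X^i * (1 - 'X) ^+ (d - i).

(* The simplex has vertex set indexed by ['I_n], and [Gam F] is the restriction
   to the face [F] of the triangulation under consideration. *)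
Definition local_h (R : nzRingType) (n : nat) (T : finType)
    (Gam : {set 'I_n} -> {set {set T}}) : {poly R} :=
  \sum_(F : {set 'I_n}) (-1) ^+ (n - #|F|) * hpoly R #|F| (Gam F).

Definition iotav (n : nat) (a : 'I_n -> int) : 'I_n -> int :=
  fun k => \sum_(j < n | (j <= k)%N) a j.

Definition is01 (n : nat) (a : 'I_n -> int) : bool :=
  [forall k, (a k == 0) || (a k == 1)].

(* Coordinates of a point of $\Omega_r$ are at most [r], so bounding them by [r]
   loses nothing and makes the ambient type finite. *)
Definition point (n r : nat) := {ffun 'I_n -> 'I_r.+1}.

Definition Omega (n r : nat) : {set point n r} :=
  [set u : point n r | (\sum_(i < n) (u i : nat))%N == r].

Definition coordz (n r : nat) (u : point n r) : 'I_n -> int :=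
  fun i => (u i : nat)%:Z.

Definition iota_diff (n r : nat) (u v : point n r) : 'I_n -> int :=
  fun k => iotav (coordz u) k - iotav (coordz v) k.

Definition esd (n r : nat) : {set {set point n r}} :=
  [set G : {set point n r} | (G \subset Omega n r) &&
    [forall u in G, forall v in G,
      is01 (iota_diff u v) || is01 (iota_diff v u)]].

Definition esd_restr (n r : nat) (F : {set 'I_n}) : {set {set point n r}} :=
  [set G in esd n r |
    [forall u in G, forall i, (i \notin F) ==> ((u i : nat) == 0%N)]].

Definition Eop (R : nzRingType) (r : nat) (p : {poly R}) : {poly R} :=
  \sum_(m < size p) p`_m *: (if (r %| m)%N then 'X^(m %/ r) else 0).

(* For [i : 'I_n], the entries $w_i$ and $w_{i+1}$ of a sequence
   $(w_0, ..., w_n)$. *)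
Definition entry (n r : nat) (w : {ffun 'I_n.+1 -> 'I_r}) (i : 'I_n) : nat :=
  w (widen_ord (leqnSn n) i).
Definition entryS (n r : nat) (w : {ffun 'I_n.+1 -> 'I_r}) (i : 'I_n) : nat :=
  w (lift ord0 i).

Definition Smirnov (n r : nat) : {set {ffun 'I_n.+1 -> 'I_r}} :=
  [set w : {ffun 'I_n.+1 -> 'I_r} |
    [&& [forall i, entry w i != entryS w i],
        (w ord0 : nat) == 0%N & (w ord_max : nat) == 0%N]].

Definition asc (n r : nat) (w : {ffun 'I_n.+1 -> 'I_r}) : nat :=
  #|[set i : 'I_n | (entry w i < entryS w i)%N]|.

(* Main.v *)
(* Multiply [h(Gamma_F, x)] by [(1 - x)^(-|F|)]: the coefficient of [x^j] becomes
   the number of multisets of [j] vertices supported on a face of [Gamma_F].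
   Summing the vertices of such a multiset gives a vector [a >= 0] supported on
   [F] with coordinate sum [r j], and this is a bijection: listed in increasing
   order, the vertices of the multiset have partial sums
   [floor ((S_k + i) / j)], [0 <= i < j], where [S_k] are the partial sums of
   [a].  Hence
   [h(Gamma_F, x) / (1 - x)^|F| = E_r (1 / (1 - x)^|F|)
      = E_r ((1 + x + ... + x^(r-1))^|F|) / (1 - x)^|F|],
   and inclusion-exclusion over [F] replaces [1 + x + ... + x^(r-1)] by
   [x + ... + x^(r-1)].  A word [w] corresponds to the sequence of residues
   [w_i - w_(i+1) mod r], whose sum is [r * asc w]. *)
Require Import Defs.
From mathcomp Require Import all_boot all_order all_algebra zify.
From mathcomp Require Import reals.

Set Implicit Arguments.
Unset Strict Implicit.
Unset Printing Implicit Defensive.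

Import Order.TTheory GRing.Theory Num.Theory.
Local Open Scope ring_scope.

(** * Partial sums of vectors of natural numbers *)

Definition psum (n : nat) (a : 'I_n -> nat) (k : nat) : nat :=
  (\sum_(i < n | (i < k)%N) a i)%N.

Section PartialSums.
Local Open Scope nat_scope.
Variable n : nat.
Implicit Types (a : 'I_n -> nat) (k : nat).

Lemma psum0 a : psum a 0 = 0.
Proof. by rewrite /psum big_pred0. Qed.

Lemma psumS a (k : 'I_n) : psum a k.+1 = psum a k + a k.
Proof.
rewrite /psum (bigD1 k) //= addnC; congr (_ + _).
by apply: eq_bigl => i; rewrite ltnS (ltn_neqAle i k) andbC.
Qed.

Lemma psum_ge a k : n <= k -> psum a k = \sum_(i < n) a i.
Proof.
by move=> nk; apply: eq_bigl => i; rewrite (leq_trans (ltn_ord i) nk).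
Qed.

Lemma leq_psum a k l : k <= l -> psum a k <= psum a l.
Proof.
move=> kl; rewrite /psum big_mkcond [leqRHS]big_mkcond /=.
apply: leq_sum => i _; case: ifP => // ik.
by rewrite (leq_trans ik kl).
Qed.

Lemma psum_sum (I : Type) (s : seq I) (a : I -> 'I_n -> nat) k :
  psum (fun i => \sum_(x <- s) a x i) k = \sum_(x <- s) psum (a x) k.
Proof. by rewrite /psum exchange_big. Qed.

Lemma psum_ext (f : nat -> nat) a :
  f 0 = 0 -> (forall k : 'I_n, f k.+1 = f k + a k) ->
  forall k, k <= n -> psum a k = f k.
Proof.
move=> f0 fS; elim=> [|k IH] kn; first by rewrite psum0.
by rewrite (psumS _ (Ordinal kn)) (fS (Ordinal kn)) /= IH // ltnW.
Qed.

Lemma psum_inj a b : (forall k, k <= n -> psum a k = psum b k) -> a =1 b.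
Proof.
move=> ab i; have := psumS a i.
by rewrite !ab ?psumS ?(ltnW (ltn_ord i)) // => /addnI.
Qed.

End PartialSums.

(** * Faces of the subdivision, described by partial sums of their vertices *)

Section Faces.
Local Open Scope nat_scope.
Variables n r : nat.
Local Notation ptsum u := (psum (fun i => nat_of_ord (fun_of_fin u i))).
Implicit Types (u v : point n r) (G : {set point n r}) (F : {set 'I_n}).

Definition pt_le u v : bool := [forall k : 'I_n, ptsum u k.+1 <= ptsum v k.+1].

Lemma pt_leP u v : reflect (forall k, ptsum u k <= ptsum v k) (pt_le u v).
Proof.
apply: (iffP forallP) => [le_uv k|//].
case: (posnP n) => [n0|n_gt0].
  have no (i : 'I_n) : False by case: i => i; rewrite n0.
  by apply: leq_sum => i; case: (no i).
case: k => [|k]; first by rewrite !psum0.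
have [kn|nk] := ltnP k n; first exact: (le_uv (Ordinal kn)).
have lt_n : n.-1 < n by rewrite prednK.
have := le_uv (Ordinal lt_n) => /=.
by rewrite prednK // !(psum_ge _ (leqnn n)) !psum_ge // leqW.
Qed.

Lemma pt_le_trans : transitive pt_le.
Proof.
move=> v u w /pt_leP uv /pt_leP vw; apply/pt_leP => k.
exact: leq_trans (uv k) (vw k).
Qed.

Lemma pt_le_refl : reflexive pt_le.
Proof. by move=> u; apply/pt_leP. Qed.

Lemma point_inj u v : (forall k, k <= n -> ptsum u k = ptsum v k) -> u = v.
Proof. by move=> uv; apply/ffunP => i; apply/val_inj/(psum_inj uv). Qed.

Lemma is01_iota_diff u v :
  is01 (iota_diff u v) =
  pt_le v u && [forall k : 'I_n, ptsum u k.+1 <= (ptsum v k.+1).+1].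
Proof.
have E w (k : 'I_n) : iotav (coordz w) k = (ptsum w k.+1)%:Z.
  by rewrite /iotav /psum /coordz -(big_morph _ PoszD (erefl 0%:Z)).
apply/forallP/andP => [H|[/forallP H1 /forallP H2] k].
  by split; apply/forallP => k; have := H k; rewrite /iota_diff !E; lia.
by have := H1 k; have := H2 k; rewrite /iota_diff !E; lia.
Qed.

(** The second clause bounds [u] by [v] only. Both bounds on a pair of vertices are recovered in
    [esdP], where the condition ranges over ordered pairs. *)
Definition face_pair u v : Prop :=
  (pt_le u v \/ pt_le v u) /\ forall k, k <= n -> ptsum u k <= (ptsum v k).+1.

Lemma esdP G :
  reflect (G \subset Omega n r /\ {in G &, forall u v, face_pair u v})
          (G \in esd n r).
Proof.
rewrite inE; apply: (iffP andP) => -[GO H]; split=> //.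
  move=> u v uG vG; move/forall_inP/(_ u uG)/forall_inP/(_ v vG): H.
  rewrite !is01_iota_diff => H; split.
    by case/orP: H => /andP[]; auto.
  case=> [|k] kn; first by rewrite !psum0.
  case/orP: H => /andP[/pt_leP H /forallP /(_ (Ordinal kn)) //= _].
  exact: leqW.
apply/forall_inP => u uG; apply/forall_inP => v vG.
have [[le_uv|le_vu] H1] := H u v uG vG; have [_ H2] := H v u vG uG;
  rewrite !is01_iota_diff ?le_uv ?le_vu /=; apply/orP; [right|left];
  by apply/forallP => k; auto.
Qed.

Lemma esd_restrP F G :
  reflect (G \in esd n r /\ {in G, forall u i, i \notin F -> (u i : nat) = 0})
          (G \in esd_restr r F).
Proof.
rewrite [G \in esd_restr r F]in_set; apply: (iffP andP) => -[GE H]; split=> //.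
  by move=> u uG i iF; move/forall_inP/(_ u uG)/forallP/(_ i): H;
     rewrite iF => /eqP.
apply/forall_inP => u uG; apply/forallP => i; apply/implyP => iF.
exact/eqP/H.
Qed.

Lemma face_total G : G \in esd n r -> {in G &, total pt_le}.
Proof. by case/esdP => _ H u v /H Hu /Hu [/orP]. Qed.

(* Between consecutive elements of [F] the partial sums are constant. *)
Lemma psum_eq_on F u v :
  (forall i, i \notin F -> (u i : nat) = 0) ->
  (forall i, i \notin F -> (v i : nat) = 0) ->
  {in F, forall i : 'I_n, ptsum u i.+1 = ptsum v i.+1} -> u = v.
Proof.
move=> u0 v0 uv; apply: point_inj; elim=> [|k IH] kn; first by rewrite !psum0.
have [iF|iF] := boolP (Ordinal kn \in F); first exact: (uv _ iF).
rewrite (psumS _ (Ordinal kn)) (psumS _ (Ordinal kn)) u0 // v0 //=.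
by rewrite !addn0 IH // ltnW.
Qed.

(* [u |-> \sum_(i in F) ptsum u i.+1] is injective on [G] modulo [#|F|]: on a
   face it is strictly monotone, and its range has width less than [#|F|]
   because the last partial sum indexed by [F] is always [r]. *)
Lemma card_face F G : 0 < r -> G \in esd_restr r F -> #|G| <= #|F|.
Proof.
move=> r_gt0 /esd_restrP[GE G0]; have /esdP[/subsetP GO GP] := GE.
have [->|[u0 u0G]] := set_0Vmem G; first by rewrite cards0.
have [F0|[i0 i0F]] := set_0Vmem F.
  have := GO _ u0G; rewrite inE big1 ?(ltn_eqF r_gt0) // => i _.
  by apply: G0 => //; rewrite F0 inE.
have F_gt0 : 0 < #|F| by rewrite card_gt0; apply/set0Pn; exists i0.
(* All coordinates beyond the largest index [m] of [F] vanish, so the partial sum up to [m] is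
   already the total [r]. *)
have [m mF max_m] := @arg_maxnP _ i0 (mem F) (fun i => i : nat) i0F.
have top u : u \in G -> ptsum u m.+1 = r.
  move=> uG; have := GO _ uG; rewrite inE => /eqP Hr.
  apply: etrans Hr.
  rewrite /psum [RHS](bigID (fun i : 'I_n => i < m.+1)) /=.
  rewrite [X in _ = _ + X]big1 ?addn0 // => i im; apply: G0 => //.
  by apply: contra im => /max_m; rewrite ltnS.
pose W u := \sum_(i in F) ptsum u i.+1.
have W_lt u v : u \in G -> v \in G -> pt_le u v -> u != v ->
    W u < W v < W u + #|F|.
  move=> uG vG /pt_leP uv neq; apply/andP; split.
    rewrite ltn_neqAle leq_sum ?andbT; last by move=> i _; apply: uv.
    apply: contra neq => /eqP Weq; apply/eqP/(@psum_eq_on F) => //;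
      [by apply: G0|by apply: G0|].
    move=> i iF; apply/eqP; rewrite eqn_leq uv /= leqNgt; apply/negP => lt.
    suff : W u < W v by rewrite Weq ltnn.
    rewrite /W (bigD1 i) //= [ltnRHS](bigD1 i) //= -addSn leq_add //.
    by apply: leq_sum.
  (* The terms at [m] agree, and each of the other [#|F| - 1] terms grows by at most one from [u] to
     [v]. *)
  rewrite /W (bigD1 m) //= [X in _ < X + _](bigD1 m) //= !top //.
  rewrite -addnA ltn_add2l -sum1_card [X in _ < _ + X](bigD1 m) //= addnCA.
  rewrite add1n ltnS -big_split /=.
  apply: leq_sum => i /andP[iF _]; rewrite addn1.
  by have [_] := GP v u vG uG; apply.
pose f u : 'I_#|F| := Ordinal (ltn_pmod (W u) F_gt0).
rewrite -[leqRHS]card_ord -(@card_in_imset _ _ f) ?max_card //.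
have key u v : u \in G -> v \in G -> pt_le u v -> f u = f v -> u = v.
  move=> uG vG uv [] /eqP fE; apply/eqP; apply/contraT => /(W_lt _ _ uG vG uv).
  case/andP=> lt1 lt2; move: fE; rewrite eq_sym (eqn_mod_dvd _ (ltnW lt1)).
  by move/dvdn_leq; rewrite subn_gt0 lt1 leqNgt ltn_subLR ?(ltnW lt1) // lt2 => /(_ isT).
move=> u v uG vG fE.
case/orP: (face_total GE uG vG) => uv; first exact: key.
by apply/esym/key.
Qed.

End Faces.

(** * Monotone integer sequences whose values differ by at most one *)

Section Balanced.
Local Open Scope nat_scope.

Lemma sum_ltn_ord i j : i <= j -> \sum_(l < j) (l < i) = i.
Proof.
move=> ij; rewrite -big_mkcond -(@big_ord_widen _ _ _ _ j (fun=> 1)) //.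
by rewrite sum1_card card_ord.
Qed.

(** Hermite's identity. Passing from [s] to [s.+1] shifts the window of summation by one: the term
    [s %/ j] leaves and [(s + j) %/ j], which is one more, enters. *)
Lemma sum_divn_shift j s : 0 < j -> \sum_(i < j) (s + i) %/ j = s.
Proof.
move=> j_gt0; elim: s => [|s IH].
  by apply: big1 => i _; rewrite add0n divn_small.
have top : (s + j) %/ j = (s %/ j).+1 by rewrite divnDr // divnn j_gt0 addn1.
have : s %/ j + \sum_(i < j) (s.+1 + i) %/ j =
       \sum_(i < j) (s + i) %/ j + (s + j) %/ j.
  rewrite -(big_ord_recr j (fun i => (s + i) %/ j)) big_ord_recl /= addn0.
  by congr (_ + _); apply: eq_bigr => i _; rewrite addSnnS.
rewrite IH top; lia.
Qed.

(** Such a sequence is determined by its sum. Comparing each [f l] with [f i], with a gain of one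
    for the indices before [i] (resp. up to [i]), traps the sum plus [i] between [j * f i] and
    [j * (f i).+1], the upper bound being strict. *)
Lemma balanced_divn (f : nat -> nat) j i :
  (forall l m, l <= m < j -> f l <= f m) ->
  (forall l m, l < j -> m < j -> f m <= (f l).+1) ->
  i < j -> f i = (\sum_(l < j) f l + i) %/ j.
Proof.
move=> f_mono f_near ij.
have lo : j * f i <= \sum_(l < j) f l + i.
  rewrite -{2}(sum_ltn_ord (ltnW ij)) -big_split /= mulnC -[X in _ * X <= _]card_ord.
  rewrite mulnC -sum_nat_const; apply: leq_sum => l _.
  have [li|il] := ltnP l i; first by rewrite addn1 f_near.
  by rewrite addn0 f_mono // il /=.
have hi : \sum_(l < j) f l + i.+1 <= j * (f i).+1.
  rewrite -{1}(sum_ltn_ord ij) -big_split /= -[X in _ <= X * _]card_ord.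
  rewrite -sum_nat_const; apply: leq_sum => l _.
  have [li|il] := ltnP l i.+1; first by rewrite addn1 ltnS f_mono // -ltnS li.
  by rewrite addn0 f_near.
have j_gt0 : 0 < j by apply: leq_trans ij.
apply/eqP; rewrite eqn_leq leq_divRL // mulnC lo /=.
by rewrite -ltnS ltn_divLR // mulnC -addnS.
Qed.

End Balanced.

(** * Multisets given by multiplicity functions, and the lists that realize them *)

Section Multisets.
Local Open Scope nat_scope.
Variable T : finType.

Definition mseq (c : T -> nat) : seq T := flatten [seq nseq (c u) u | u <- enum T].

Lemma big_mseq (c : T -> nat) (P : pred T) (F : T -> nat) :
  \sum_(u <- mseq c | P u) F u = \sum_(u | P u) c u * F u.
Proof.
rewrite big_flatten big_map big_enum /= [RHS]big_mkcond /=.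
apply: eq_bigr => u _; rewrite big_nseq_cond; case: ifP => // _.
by rewrite iter_addn_0 mulnC.
Qed.

Lemma size_mseq (c : T -> nat) : size (mseq c) = \sum_u c u.
Proof.
by rewrite -sum1_size big_mseq; apply: eq_bigr => u _; rewrite muln1.
Qed.

Lemma count_mem_mseq (c : T -> nat) u : count_mem u (mseq c) = c u.
Proof. by rewrite -sum1_count big_mseq big_pred1_eq muln1. Qed.

Lemma perm_mseq_count (s : seq T) : perm_eq (mseq (fun u => count_mem u s)) s.
Proof. by apply/allP => u _ /=; rewrite count_mem_mseq. Qed.

Lemma mem_mseq (c : T -> nat) u : (u \in mseq c) = (c u != 0).
Proof. by rewrite -has_pred1 has_count count_mem_mseq lt0n. Qed.

End Multisets.

(** * Multisets on faces correspond to lattice points of dilates *)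

Section Splitting.
Local Open Scope nat_scope.
Variables n r : nat.
Local Notation ptsum u := (psum (fun i => nat_of_ord (fun_of_fin u i))).
Implicit Types (a : 'I_n -> nat) (F : {set 'I_n}).

(** The [i]-th of the [j] points into which [a] splits: coordinates are differences of consecutive
    partial sums [(S_k + i) %/ j]. When [a] has total [r * j] and [i < j], these differences are at
    most [r], so [inord] does not alter them. *)
Definition split_pt a (j i : nat) : point n r :=
  [ffun k : 'I_n => inord ((psum a k.+1 + i) %/ j - (psum a k + i) %/ j)].

Lemma eq_split_pt a b : a =1 b -> split_pt a =2 split_pt b.
Proof.
move=> ab j i; apply/ffunP => k; rewrite !ffunE.
by rewrite /psum; do 2 rewrite (eq_bigr _ (fun l _ => ab l)).
Qed.

Lemma split_ptE a j i k : \sum_i a i = r * j -> i < j ->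
  split_pt a j i k = (psum a k.+1 + i) %/ j - (psum a k + i) %/ j :> nat.
Proof.
move=> aE ij; have j_gt0 : 0 < j by apply: leq_trans ij.
rewrite ffunE inordK // ltnS; apply: leq_trans (leq_subr _ _) _.
rewrite -ltnS ltn_divLR // mulSn addnC -addSn leq_add //.
by rewrite -aE -(psum_ge _ (leqnn n)) leq_psum.
Qed.

Lemma ptsum_split a j i k : \sum_i a i = r * j -> i < j -> k <= n ->
  ptsum (split_pt a j i) k = (psum a k + i) %/ j.
Proof.
move=> aE ij; move: k; apply: psum_ext => [|k]; first by rewrite psum0 divn_small.
by rewrite split_ptE // subnKC // leq_div2r // leq_add2r leq_psum.
Qed.

Lemma split_Omega a j i : \sum_i a i = r * j -> i < j ->
  split_pt a j i \in Omega n r.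
Proof.
move=> aE ij; have j_gt0 : 0 < j by apply: leq_trans ij.
rewrite inE -(psum_ge _ (leqnn n)) ptsum_split // psum_ge // aE.
by rewrite divnMDl // divn_small // addn0.
Qed.

Lemma split_face_pair a j i l : \sum_i a i = r * j -> i < j -> l < j ->
  face_pair (split_pt a j i) (split_pt a j l).
Proof.
move=> aE ij lj; have j_gt0 : 0 < j by apply: leq_trans ij.
split=> [|k kn].
  have [il|/ltnW li] := leqP i l; [left|right];
    by apply/forallP => k; rewrite !ptsum_split // leq_div2r // leq_add2l.
rewrite !ptsum_split //.
(* Adding [j] to the numerator raises the quotient by exactly one, and [i < j]. *)
have -> : ((psum a k + l) %/ j).+1 = (psum a k + l + j) %/ j.
  by rewrite [RHS]divnDr // divnn j_gt0 addn1.
rewrite leq_div2r //; by rewrite -addnA leq_add2l ltnW // ltn_addl.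
Qed.

Lemma sum_split a j k : \sum_i a i = r * j ->
  \sum_(i < j) (split_pt a j i k : nat) = a k.
Proof.
move=> aE; have [j0|j_gt0] := posnP j.
  move: aE; rewrite j0 muln0 big_ord0 => /eqP; rewrite sum_nat_eq0.
  by move/forallP/(_ k)/eqP.
under eq_bigr do rewrite split_ptE //.
rewrite sumnB; last by move=> i _; rewrite leq_div2r // leq_add2r leq_psum.
by rewrite !sum_divn_shift // psumS addKn.
Qed.

(** A multiset on a face is recovered from its vector sum. Sort it by [pt_le], which is total on a
    face: for each [k] the partial sums at [k] are then monotone with spread at most one, so
    [balanced_divn] computes them. *)
Lemma perm_split (G : {set point n r}) (s : seq (point n r)) :
  G \in esd n r -> {subset s <= G} ->
  perm_eq s [seq split_pt (fun k => \sum_(u <- s) (u k : nat)) (size s) i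
            | i <- iota 0 (size s)].
Proof.
move=> GE sG; have /esdP[/subsetP GO GP] := GE.
set a := fun k : 'I_n => _.
have aE : \sum_i a i = r * size s.
  rewrite exchange_big /= -sum1_size big_distrr /=.
  apply: eq_big_seq => u /sG /GO; rewrite inE => /eqP ->.
  by rewrite muln1.
pose t := sort (@pt_le n r) s.
have tE : perm_eq t s by rewrite perm_sort.
have szt : size t = size s by rewrite size_sort.
have t_sorted : sorted (@pt_le n r) t.
  by apply: (sort_sorted_in (face_total GE)); apply/allP.
rewrite perm_sym -(permPr tE) perm_sym.
suff -> : [seq split_pt a (size s) i | i <- iota 0 (size s)] = t by [].
(* The head of a nonempty list serves as default value for [nth]. *)
case E : s => [|x0 s']; first by rewrite /t E.
rewrite -{}E; apply: (@eq_from_nth _ x0); first by rewrite size_map size_iota.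
rewrite size_map size_iota => i ilt.
rewrite (nth_map 0) ?size_iota // nth_iota // add0n.
have tG l : l < size s -> nth x0 t l \in G.
  by move=> lt; apply: sG; rewrite -(perm_mem tE) mem_nth // szt.
apply: point_inj => k kn; rewrite ptsum_split //.
have -> : psum a k = \sum_(l < size s) ptsum (nth x0 t l) k.
  by rewrite /a psum_sum -(perm_big _ tE) (big_nth x0) big_mkord szt.
symmetry; apply: (@balanced_divn (fun l => ptsum (nth x0 t l) k)) => //.
  move=> l m /andP[lm ms]; apply/pt_leP.
  apply: (sorted_leq_nth (@pt_le_trans n r) (@pt_le_refl n r) x0 t_sorted) => //;
    by rewrite inE szt // (leq_ltn_trans lm).
by move=> l m ls ms; have [_] := GP _ _ (tG m ms) (tG l ls); apply.
Qed.

Definition supp (T : finType) N (c : {ffun T -> 'I_N.+1}) : {set T} :=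
  [set u | c u != ord0].

(** The bounds [N] and [M] only make the ambient types finite: multiplicities are at most [j] and
    coordinates of the vector sum at most [r * j]. *)
Lemma card_multisets F (N M j : nat) : j <= N -> r * j <= M ->
  #|[set c : {ffun point n r -> 'I_N.+1} |
      (supp c \in esd_restr r F) && (\sum_u (c u : nat) == j)]| =
  #|[set a : {ffun 'I_n -> 'I_M.+1} |
      [forall i, (i \notin F) ==> (a i == ord0)] && (\sum_i (a i : nat) == r * j)]|.
Proof.
move=> jN jM; set A := [set c | _]; set B := [set a | _].
pose wt (c : {ffun point n r -> 'I_N.+1}) (k : 'I_n) :=
  \sum_u c u * (u k : nat).
pose f c : {ffun 'I_n -> 'I_M.+1} := [ffun k => inord (wt c k)].
have AP c : c \in A -> [/\ supp c \in esd_restr r F, \sum_u (c u : nat) = j,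
    \sum_k wt c k = r * j & forall k, f c k = wt c k :> nat].
  rewrite inE => /andP[cF /eqP cj].
  have /esd_restrP[/esdP[/subsetP cO _] _] := cF.
  have wtE : \sum_k wt c k = r * j.
    rewrite exchange_big /= -cj big_distrr /=; apply: eq_bigr => u _.
    rewrite -big_distrr /= mulnC; have [->|cu] := eqVneq (c u) ord0.
      by rewrite !muln0.
    by have := cO u; rewrite !inE => /(_ cu) /eqP ->.
  split=> // k; rewrite ffunE inordK // ltnS; apply: leq_trans jM.
  by rewrite -wtE (bigD1 k) //= leq_addr.
have f_inj : {in A &, injective f}.
  move=> c d /AP[cF cj cw fc] /AP[dF dj dw fd] fE.
  (* Injectivity: each multiset is a rearrangement of the splitting of its own vector sum. *)
  have key e : supp e \in esd_restr r F -> \sum_u (e u : nat) = j ->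
      perm_eq (mseq (fun u => e u : nat))
        [seq split_pt (wt e) j i | i <- iota 0 j].
    move=> /esd_restrP[eE _] ej.
    have sub : {subset mseq (fun u => e u : nat) <= supp e}.
      by move=> u; rewrite mem_mseq inE.
    have := perm_split eE sub; rewrite size_mseq ej => /perm_trans; apply.
    rewrite (eq_map (g := split_pt (wt e) j)) // => i.
    by apply: eq_split_pt => k; rewrite big_mseq.
  have wcd : wt c =1 wt d by move=> k; rewrite -fc -fd fE.
  have := key c cF cj; rewrite (eq_map (eq_split_pt wcd j)).
  rewrite perm_sym => /(perm_trans (key d dF dj)) /permP dc.
  apply/ffunP => u; apply: val_inj => /=.
  by rewrite -(count_mem_mseq (fun u => c u : nat)) -dc count_mem_mseq.
rewrite -(card_in_imset f_inj); apply: eq_card => a; apply/imsetP/idP.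
  case=> c /AP[cF cj cw fc] ->; rewrite inE.
  under [X in _ && (X == _)]eq_bigr do rewrite fc.
  rewrite cw eqxx andbT; apply/forallP => i; apply/implyP => iF.
  apply/eqP/val_inj; apply: etrans (fc i) _.
  rewrite /wt big1 // => u _.
  have [->|cu] := eqVneq (c u) ord0; first by rewrite mul0n.
  have /esd_restrP[_ c0] := cF.
  by rewrite c0 ?muln0 // inE.
rewrite inE => /andP[/forall_inP aF /eqP aE].
(* Surjectivity: the multiplicities of the splitting of [a] give the preimage. *)
pose s := [seq split_pt (fun i => a i : nat) j i | i <- iota 0 j].
have sP u : u \in s -> exists2 i, i < j & u = split_pt (fun i => a i : nat) j i.
  by case/mapP => i; rewrite mem_iota => ij ->; exists i.
have szs : size s = j by rewrite size_map size_iota.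
pose c : {ffun point n r -> 'I_N.+1} := [ffun u => inord (count_mem u s)].
have cE u : c u = count_mem u s :> nat.
  by rewrite ffunE inordK // ltnS (leq_trans _ jN) // -szs count_size.
have cs u : (u \in supp c) = (u \in s).
  by rewrite inE -val_eqE /= cE -has_pred1 has_count lt0n.
exists c.
  rewrite inE; apply/andP; split.
    apply/esd_restrP; split.
      apply/esdP; split.
        apply/subsetP => u; rewrite cs => /sP[i ij ->].
        exact: split_Omega.
      move=> u v; rewrite !cs => /sP[i ij ->] /sP[l lj ->].
      exact: split_face_pair.
    move=> u; rewrite cs => /sP[i ij ->] k kF.
    by rewrite split_ptE // psumS (eqP (aF _ kF)) addn0 subnn.
  apply/eqP; rewrite -[RHS]szs -(perm_size (perm_mseq_count s)) size_mseq.
  by apply: eq_bigr => u _; rewrite cE.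
apply/ffunP => k; apply: val_inj; rewrite ffunE.
suff -> : wt c k = a k by rewrite inord_val.
rewrite -(sum_split k aE) /wt; under eq_bigr do rewrite cE.
rewrite -big_mseq (perm_big _ (perm_mseq_count s)) big_map /=.
by rewrite -[X in iota 0 X]subn0 big_mkord.
Qed.

End Splitting.

(** * Congruence of polynomials modulo ['X^N], standing in for power series *)

Section Truncation.
Variables (R : comNzRingType) (N : nat).
Implicit Types p q : {poly R}.

Definition eqmod p q : Prop := forall i, (i < N)%N -> p`_i = q`_i.

Lemma eqmod_trans p q s : eqmod p q -> eqmod q s -> eqmod p s.
Proof. by move=> pq qs i iN; rewrite pq // qs. Qed.

Lemma eqmod_sym p q : eqmod p q -> eqmod q p.
Proof. by move=> pq i iN; rewrite pq. Qed.

Lemma eqmodM p q p' q' : eqmod p q -> eqmod p' q' -> eqmod (p * p') (q * q').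
Proof.
move=> pq pq' i iN; rewrite !coefM; apply: eq_bigr => k _.
rewrite pq ?pq' //; first exact: leq_ltn_trans (leq_subr _ _) iN.
by apply: leq_trans iN; rewrite ltnS -ltnS.
Qed.

Lemma eqmodX p q m : eqmod p q -> eqmod (p ^+ m) (q ^+ m).
Proof.
move=> pq; elim: m => [|m IH]; first by rewrite !expr0.
by rewrite !exprS; apply: eqmodM.
Qed.

Lemma eqmod_sum (I : finType) (P : pred I) (F G : I -> {poly R}) :
  (forall i, P i -> eqmod (F i) (G i)) ->
  eqmod (\sum_(i | P i) F i) (\sum_(i | P i) G i).
Proof.
by move=> FG j jN; rewrite !coef_sum; apply: eq_bigr => i /FG; apply.
Qed.

Lemma eqmod_subXn p : eqmod (p - 'X^N) p.
Proof. by move=> i iN; rewrite coefB coefXn (ltn_eqF iN) subr0. Qed.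

End Truncation.

(** * Generating functions of multisets, the operator [Eop], and the local h-polynomial *)

Section GeneratingFunctions.
Variable R : comNzRingType.

(** The size bound guarantees that grouping faces by cardinality up to [d] misses none. *)
Lemma hpolyE (T : finType) d (D : {set {set T}}) :
  {in D, forall G : {set T}, (#|G| <= d)%N} ->
  hpoly R d D = \sum_(G in D) 'X^#|G| * (1 - 'X) ^+ (d - #|G|).
Proof.
move=> leD; rewrite /hpoly.
rewrite [RHS](partition_big (fun G => inord #|pred_of_set G| : 'I_d.+1) xpredT) //=.
apply: eq_bigr => i _.
rewrite (eq_bigr (fun=> 'X^i * (1 - 'X) ^+ (d - i))); last first.
  by move=> G /andP[/leD Gd /eqP <-]; rewrite inordK.
rewrite sumr_const -mulrA mulr_natl /fface; congr (_ *+ _); apply: eq_card => G.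
rewrite inE unfold_in /=; apply: andb_id2l => /leD Gd.
by rewrite -val_eqE /= inordK.
Qed.

(** For a fixed support [G], the multiplicities of the vertices of [G] range independently over
    [1..N], and all others are zero; the sum over this fibre is a product. *)
Lemma sum_supp (T : finType) N (D : {set {set T}}) :
  \sum_(c : {ffun T -> 'I_N.+1} | supp c \in D) 'X^(\sum_u (c u : nat)) =
  \sum_(G in D) (\sum_(1 <= k < N.+1) 'X^k) ^+ #|G| :> {poly R}.
Proof.
rewrite (partition_big (@supp T N) (mem D)) //=; apply: eq_bigr => G GD.
rewrite -prodr_const [RHS]big_mkcond /=.
transitivity (\prod_(u : T) \sum_(k < N.+1 | (k != ord0) == (u \in G)) 'X^k : {poly R}).
  rewrite bigA_distr_big_dep; apply: eq_big => [c|c _]; last by rewrite prodrXr.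
  apply/andP/familyP => [[_ /eqP <-] u|cG]; first by rewrite unfold_in inE eqxx.
  suff -> : supp c = G by split.
  by apply/setP => u; have := cG u; rewrite unfold_in inE => /eqP.
apply: eq_bigr => u _; case: (u \in G).
  rewrite big_add1 /= big_mkord big_mkcond big_ord_recl /= add0r.
  by apply: eq_bigr => k _.
by rewrite (big_pred1 ord0) ?expr0 // => k; rewrite /= eqbF_neg negbK.
Qed.

Lemma coef_sumXn (T : finType) (P : pred T) (f : T -> nat) j :
  (\sum_(c | P c) 'X^(f c) : {poly R})`_j = #|[set c | P c && (f c == j)]|%:R.
Proof.
rewrite coef_sum -sum1_card natr_sum [RHS]big_mkcond [LHS]big_mkcond /=.
apply: eq_bigr => c _; rewrite inE coefXn eq_sym.
by case: (P c) => //=; case: (f c == j).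
Qed.

Lemma geomXM (N : nat) :
  (1 - 'X) * (\sum_(1 <= k < N.+1) 'X^k) = 'X - 'X^(N.+1) :> {poly R}.
Proof.
elim: N => [|N IH]; first by rewrite big_geq // mulr0 expr1 subrr.
rewrite big_nat_recr //= mulrDr IH; rewrite mulrBl mul1r -exprS.
by rewrite addrA subrK.
Qed.

Lemma geomM (N : nat) : (1 - 'X) * (\sum_(k < N) 'X^k) = 1 - 'X^N :> {poly R}.
Proof. by rewrite -[RHS]opprB subrX1 -mulNr opprB. Qed.

Section Eop.
Variable r : nat.
Hypothesis r_gt0 : (0 < r)%N.

Lemma coef_Eop (p : {poly R}) j : (Eop r p)`_j = p`_(r * j).
Proof.
rewrite /Eop coef_sum; have [lt|ge] := ltnP (r * j) (size p).
  rewrite (bigD1 (Ordinal lt)) //= big1 => [|m neq].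
    by rewrite dvdn_mulr // mulKn // coefZ coefXn eqxx mulr1 addr0.
  case: ifP => [dv|_]; last by rewrite scaler0 coef0.
  rewrite coefZ coefXn; case: eqP => [jE|_]; last by rewrite mulr0.
  by case/eqP: neq; apply: val_inj; rewrite /= jE mulnC divnK.
rewrite nth_default // big1 // => m _.
case: ifP => [dv|_]; last by rewrite scaler0 coef0.
rewrite coefZ coefXn; case: eqP => [jE|_]; last by rewrite mulr0.
by have := ltn_ord m; rewrite -(divnK dv) -jE mulnC ltnNge ge.
Qed.

Lemma Eop_sum (I : Type) (s : seq I) (P : pred I) (F : I -> {poly R}) :
  Eop r (\sum_(i <- s | P i) F i) = \sum_(i <- s | P i) Eop r (F i).
Proof.
apply/polyP => j; rewrite coef_Eop !coef_sum.
by apply: eq_bigr => i _; rewrite coef_Eop.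
Qed.

Lemma EopM_signr (p : {poly R}) k : Eop r ((-1) ^+ k * p) = (-1) ^+ k * Eop r p.
Proof.
apply/polyP => j; rewrite coef_Eop -(rmorph_sign (@polyC R)) !coefCM.
by rewrite coef_Eop.
Qed.

Lemma EopXn m : Eop r 'X^m = if (r %| m)%N then 'X^(m %/ r) else 0 :> {poly R}.
Proof.
apply/polyP => j; rewrite coef_Eop coefXn; case: ifP => dv.
  by rewrite coefXn -{1}(divnK dv) mulnC eqn_pmul2r.
by rewrite coef0; case: eqP => // mE; rewrite -mE dvdn_mulr in dv.
Qed.

(** Multiplying by a power of ['X^r] shifts exponents by a multiple of [r], which respects the
    selection of exponents divisible by [r]. *)
Lemma EopM_comp (p q : {poly R}) : Eop r (p * (q \Po 'X^r)) = Eop r p * q.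
Proof.
have qE : q = \sum_(i < size q) q`_i *: 'X^i by rewrite -poly_def coefK.
rewrite comp_polyE [X in _ = _ * X]qE !mulr_sumr Eop_sum.
apply: eq_bigr => k _; apply/polyP => j.
rewrite -!scalerAr -exprM coef_Eop !coefZ !coefMXn coef_Eop mulnBr.
by rewrite ltn_pmul2l.
Qed.

(** Division with remainder of the exponent by [r]. *)
Lemma sum_block N :
  \sum_(t < r * N) 'X^t = (\sum_(t < r) 'X^t) * ((\sum_(t < N) 'X^t) \Po 'X^r)
  :> {poly R}.
Proof.
elim: N => [|N IH]; first by rewrite muln0 !big_ord0 comp_poly0 mulr0.
rewrite big_ord_recr /= comp_polyD mulrDr -IH comp_Xn_poly mulnSr big_split_ord /=.
congr (_ + _); rewrite mulr_suml -exprM.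
by apply: eq_bigr => t _; rewrite exprD mulrC.
Qed.

(* Both sides, divided by [(1 - 'X) ^+ #|F|], are the Hilbert series of the face
   ring of the restriction: its [j]-th coefficient counts the lattice points of
   the [r * j]-th dilate of the face [F]. *)
Lemma hpoly_esd n (F : {set 'I_n}) :
  hpoly R #|F| (esd_restr r F) = Eop r ((\sum_(k < r) 'X^k) ^+ #|F|).
Proof.
have leF := fun G (GF : G \in esd_restr r F) => card_face r_gt0 GF.
rewrite hpolyE //.
suff H N : eqmod N.+1 (\sum_(G in esd_restr r F) 'X^#|G| * (1 - 'X) ^+ (#|F| - #|G|))
    (Eop r ((\sum_(k < r) 'X^k) ^+ #|F|) : {poly R}).
  by apply/polyP => i; apply: (H i).
(* With [M.+1 = r * N.+1], [sum_block] factors the geometric sum with [M.+1] terms, and [r * j <= M]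
   for every [j <= N]. *)
pose M := (r * N.+1).-1.
have ME : M.+1 = (r * N.+1)%N by rewrite prednK // muln_gt0 r_gt0.
pose H1 : {poly R} :=
  \sum_(c : {ffun point n r -> 'I_N.+1} | supp c \in esd_restr r F)
    'X^(\sum_u (c u : nat)).
pose H2 : {poly R} :=
  \sum_(a : {ffun 'I_n -> 'I_M.+1} | [forall i, (i \notin F) ==> (a i == ord0)])
    'X^(\sum_i (a i : nat)).
have H12 : eqmod N.+1 H1 (Eop r H2).
  move=> j jN; rewrite coef_Eop !coef_sumXn (@card_multisets _ _ _ _ M) //.
  by rewrite -ltnS ME ltn_pmul2l.
have H2E : Eop r H2 =
    Eop r ((\sum_(k < r) 'X^k) ^+ #|F|) * (\sum_(k < N.+1) 'X^k) ^+ #|F|.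
  rewrite -EopM_comp; congr Eop; rewrite [X in _ * X]rmorphXn /= -exprMn -sum_block -ME.
  rewrite -prodr_const [RHS]big_mkcond /=.
  transitivity (\prod_(i < n)
      \sum_(k < M.+1 | (i \notin F) ==> (k == ord0)) 'X^k : {poly R}).
    rewrite bigA_distr_big_dep; apply: eq_big => [a|a _]; last by rewrite prodrXr.
    by apply/forallP/familyP.
  apply: eq_bigr => i _; case: (i \in F) => //=.
  by rewrite (big_pred1 ord0) ?expr0.
(* Multiplication by [(1 - 'X) ^+ #|F|] clears the truncated geometric sums, up to terms of degree
   above [N]. *)
apply: (@eqmod_trans _ _ _ ((1 - 'X) ^+ #|F| * H1)); last first.
  apply: eqmod_trans (eqmodM (fun _ _ => erefl) H12) _.
  rewrite H2E mulrCA -exprMn geomM -[X in eqmod _ _ X]mulr1 -{2}(expr1n _ #|F|).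
  by apply: eqmodM => //; apply: eqmodX; apply: eqmod_subXn.
(* For each face, [#|G|] of the factors [1 - 'X] turn the geometric sums starting at ['X] into
   ['X^#|G|] modulo ['X^N.+1]; the rest remain. *)
apply: eqmod_sym; rewrite /H1 sum_supp mulr_sumr; apply: eqmod_sum => G GF.
rewrite -{1}(subnK (leF _ GF)) exprD -mulrA -exprMn geomXM mulrC.
by apply: eqmodM => //; apply: eqmodX; apply: eqmod_subXn.
Qed.

Lemma local_h_esd n :
  local_h R (@esd_restr n r) = Eop r ((\sum_(1 <= k < r) 'X^k) ^+ n).
Proof.
have E : \sum_(1 <= k < r) 'X^k = \sum_(k < r) 'X^k + (-1) :> {poly R}.
  rewrite -(prednK r_gt0) big_add1 /= big_mkord big_ord_recl expr0 addrC addKr.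
  by apply: eq_bigr.
(* Expanding the product over coordinates, [F] collects those where the full geometric sum is
   chosen, and its complement those where [-1] is. *)
rewrite E -[n in RHS]card_ord -prodr_const bigA_distr Eop_sum.
apply: eq_bigr => F _; rewrite hpoly_esd -EopM_signr; congr Eop.
rewrite (bigID (mem F)) /= mulrC; congr (_ * _).
  by rewrite [RHS](eq_bigr (fun=> \sum_(k < r) 'X^k)) ?prodr_const // => i ->.
rewrite [RHS](eq_bigr (fun=> -1)) => [|i /negbTE -> //].
by rewrite prodr_const -[X in (X - _)%N]card_ord -(cardC (mem F)) addKn.
Qed.

End Eop.
End GeneratingFunctions.

(** * Words without equal neighbours, encoded by their cyclic differences *)

Section SmirnovWords.
Variables (n r : nat).
Hypothesis r_gt0 : (0 < r)%N.
Implicit Types (w : {ffun 'I_n.+1 -> 'I_r}) (d : {ffun 'I_n -> 'I_r}).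

Local Notation ptsum d := (psum (fun i => nat_of_ord (fun_of_fin d i))).

(** The summand [r] keeps the truncated subtraction exact, since entries are below [r]. *)
Definition steps w : {ffun 'I_n -> 'I_r} :=
  [ffun i => Ordinal (ltn_pmod (entry w i + r - entryS w i) r_gt0)].

(* The entry at [k] is [- ptsum d k] modulo [r], shifted so that the truncated
   subtraction is exact. *)
Definition word_of_steps d : {ffun 'I_n.+1 -> 'I_r} :=
  [ffun k : 'I_n.+1 => Ordinal (ltn_pmod (r * ptsum d n - ptsum d k) r_gt0)].

Lemma word_of_stepsK : cancel word_of_steps steps.
Proof.
move=> d; apply/ffunP => i; apply: val_inj.
rewrite !ffunE /= /entry /entryS !ffunE /= /bump /= add1n.
have le1 : (ptsum d i.+1 <= r * ptsum d n)%N.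
  rewrite (leq_trans (leq_psum _ (ltn_ord i))) // leq_pmull //.
move: le1; rewrite psumS; set S := (r * _)%N; set s := ptsum d i => le1.
set x := (S - (s + d i))%N; have -> : (S - s = x + d i)%N by rewrite /x; lia.
have xr : (x %% r < r)%N by rewrite ltn_mod.
apply/eqP; rewrite -[X in _ == X](modn_small (ltn_ord (d i))).
(* Adding back the subtracted residue removes the truncated subtraction from the congruence. *)
rewrite -(eqn_modDr (x %% r)%N) subnK; last by rewrite (leq_trans (ltnW xr)) // leq_addl.
by rewrite modnDr modn_mod addnC modnDmr addnC.
Qed.

(** Reduction modulo [r] discards one [r] at a descent and nothing at an ascent. *)
Lemma stepsE w i : w \in Smirnov n r ->
  (steps w i + entryS w i = entry w i + r * (entry w i < entryS w i))%N.
Proof.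
rewrite inE => /and3P[/forallP /(_ i) neq _ _]; rewrite ffunE /=.
have := ltn_ord (w (widen_ord (leqnSn n) i)); have := ltn_ord (w (lift ord0 i)).
rewrite -/(entry w i) -/(entryS w i) => lt1 lt2.
case: ltngtP neq => // lt _.
  by rewrite modn_small ?muln1; lia.
have -> : (entry w i + r - entryS w i = entry w i - entryS w i + r)%N by lia.
by rewrite modnDr modn_small ?muln0; lia.
Qed.

(** Telescoping of [stepsE], starting from [w ord0 = 0]. At the last index, where [w] vanishes
    again, it yields [sum_steps]. *)
Lemma ptsum_steps w (k : 'I_n.+1) : w \in Smirnov n r ->
  (ptsum (steps w) k + w k =
   r * psum (fun i => (entry w i < entryS w i)%N : nat) k)%N.
Proof.
move=> wS; have /and3P[_ /eqP w0 _] : [&& true, (w ord0 : nat) == 0%N & true].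
  by move: wS; rewrite inE => /and3P[_ -> _].
case: k => k; elim: k => [|k IH] kn.
  rewrite !psum0 muln0 add0n -[RHS]w0; congr (nat_of_ord (w _)); exact: val_inj.
have kn' : (k < n)%N := kn.
rewrite !(psumS _ (Ordinal kn')) /= mulnDr -(IH (ltnW kn)).
rewrite -!addnA; congr (_ + _)%N.
have -> : w (Ordinal kn) = entryS w (Ordinal kn') :> nat.
  by congr (nat_of_ord (w _)); apply: val_inj.
rewrite stepsE //; congr (_ + _)%N.
by congr (nat_of_ord (w _)); apply: val_inj.
Qed.

Lemma sum_steps w : w \in Smirnov n r ->
  (\sum_i (steps w i : nat) = r * asc w)%N.
Proof.
move=> wS; have := ptsum_steps ord_max wS.
have /and3P[_ _ /eqP ->] : [&& true, true & (w ord_max : nat) == 0%N].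
  by move: wS; rewrite inE => /and3P[_ _ ->].
rewrite addn0 !psum_ge // => ->; congr (_ * _)%N.
by rewrite /asc -sum1_card [RHS]big_mkcond /=;
   apply: eq_bigr => i _; rewrite inE; case: ifP.
Qed.

(** Positive steps mean distinct neighbours. The round trip forces the first entry to be zero, and
    divisibility of the total then forces the last one to be zero. The round trip is also the
    condition that reindexing along [steps] produces. *)
Lemma Smirnov_steps w : (w \in Smirnov n r) =
  [&& [forall i, (0 < steps w i)%N], (r %| \sum_i (steps w i : nat))%N
    & word_of_steps (steps w) == w].
Proof.
apply/idP/and3P => [wS|[/forallP pos dv /eqP wE]].
  split; last 1 first.
  - apply/eqP/ffunP => k; apply: val_inj; rewrite ffunE /=.
    have := ptsum_steps k wS; set s := psum _ k; set t := psum _ k => st.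
    have : (s <= ptsum (steps w) n)%N by rewrite leq_psum // -ltnS.
    set S := ptsum (steps w) n => sS.
    have Sr : (s <= r * S)%N by rewrite (leq_trans sS) // leq_pmull.
    apply/eqP; rewrite -[X in _ == X](modn_small (ltn_ord (w k))).
    rewrite -(eqn_modDl s) subnKC // st.
    by rewrite [X in X == _]modnMr modnMr.
  - apply/forallP => i; have := stepsE i wS; have := wS.
    rewrite inE => /and3P[/forallP /(_ i) neq _ _].
    have : (entryS w i < r)%N := ltn_ord _.
    by case: ltngtP neq => //; lia.
  - by rewrite sum_steps // dvdn_mulr.
rewrite inE; apply/and3P; split.
- apply/forallP => i; apply: contraTneq (pos i) => eq_i.
  by rewrite ffunE /= eq_i addKn modnn.
- by rewrite -wE ffunE /= psum0 subn0 modnMr.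
- rewrite -wE ffunE /= psum_ge //.
  by rewrite -/(dvdn _ _) dvdn_sub // dvdn_mulr.
Qed.

(** Expanding the power gives a sum over vectors of nonzero residues; [Eop] keeps those with total
    divisible by [r], and these are the step vectors of the words, with total [r * asc w]. *)
Lemma Eop_Smirnov (R : comNzRingType) :
  Eop r ((\sum_(1 <= k < r) 'X^k) ^+ n) = \sum_(w in Smirnov n r) 'X^(asc w)
  :> {poly R}.
Proof.
have -> : \sum_(1 <= k < r) 'X^k = \sum_(k < r | (0 < k)%N) 'X^k :> {poly R}.
  by rewrite big_geq_mkord.
rewrite -[X in _ ^+ X]card_ord -prodr_const bigA_distr_big_dep Eop_sum //.
rewrite (eq_bigr (fun d : {ffun 'I_n -> 'I_r} =>
   if (r %| \sum_i (d i : nat))%N then 'X^((\sum_i (d i : nat)) %/ r) else 0));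
  last first.
  by move=> d _; rewrite prodrXr EopXn.
rewrite -big_mkcondr /= (reindex_onto steps word_of_steps) /=; last first.
  by move=> d _; apply: word_of_stepsK.
apply: eq_big => [w|w].
  by rewrite Smirnov_steps -andbA; congr (_ && _).
rewrite -andbA => /and3P[/familyP pos dv wE].
rewrite sum_steps ?mulKn // Smirnov_steps dv wE /= andbT.
exact/forallP.
Qed.

End SmirnovWords.

Theorem theorem1p1 (R : realType) (n r : nat) (hn : (0 < n)%N) (hr : (0 < r)%N) :
  local_h R (@esd_restr n r) = Eop r ((\sum_(1 <= k < r) 'X^k) ^+ n : {poly R})
  /\ Eop r ((\sum_(1 <= k < r) 'X^k) ^+ n : {poly R})
     = \sum_(w in Smirnov n r) 'X^(asc w).
Proof.
by split; [apply: local_h_esd | apply: Eop_Smirnov].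
Qed.
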